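(* Let $a,b$ be real numbers with $0<a<b$ and let $q\ge1$. Then $$\left|-\ln I(a,b)+\frac{\ln\left(a^{b}/b^{a}\right)}{2(b-a)}+\frac12\ln A(a,b)\right|$$ $$\le\frac{A(a,b)^{1-\frac1q}}{4\cdot 12^{1/q}}\left\{\bigl[b^{-q}(2a+b)+a^{-q}(4a+5b)\bigr]^{1/q}+\bigl[a^{-q}(a+2b)+b^{-q}(5a+4b)\bigr]^{1/q}\right\}.$$
   Context: For $0<a<b$: $A(a,b)=\frac{a+b}{2}$ (arithmetic mean) and $I(a,b)=\frac1e\left(\frac{b^{b}}{a^{a}}\right)^{\frac{1}{b-a}}$ (identric mean). *)

(* Defs.v *)
From Stdlib Require Import Reals.
Open Scope R_scope.

(** [Rpower x y] is [exp (y * ln x)], which is the real power [x^y] only for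
    [0 < x]; below, every base is positive as soon as [0 < a < b]. *)

Definition arithmetic_mean (a b : R) : R := (a + b) / 2.

Definition identric_mean (a b : R) : R :=
  1 / exp 1 * Rpower (Rpower b b / Rpower a a) (1 / (b - a)).

(* Main.v *)
(** In each of the two sums raised to the power [1 / q] the weights of
    [a^(-q)] and [b^(-q)] add up to [12 A], where [A] is the arithmetic mean, so
    Hoelder's inequality reduces the bound to its case [q = 1]. That case is
    homogeneous: with [t = b / a > 1] it reads
      [| 1 - (2 t + 1) ln t / (2 (t - 1)) + ln ((1 + t) / 2) / 2 |
         <= (10 + 7 t + 7 / t) / 48].
    It follows from [1 - 1 / t <= ln t <= (t - 1) / sqrt t] and
    [ln x >= 2 (x - 1) / (x + 1)] at [x = (1 + t) / 2]; what remains is a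
    polynomial inequality in [sqrt t]. *)

Require Import Defs.
From Stdlib Require Import Reals.
From Stdlib Require Import Lra.
From Coquelicot Require Import Coquelicot.
Open Scope R_scope.

(** By convexity [exp] lies above its tangent at [m = th * ln z]. Evaluating this at [ln z] and at
    [0] with weights [th] and [1 - th] makes the slope terms cancel. *)
Lemma Rpower_le_tangent (z th : R) :
  0 < z -> 0 <= th <= 1 -> Rpower z th <= 1 + th * (z - 1).
Proof.
intros hz hth.
set (m := th * ln z).
assert (exp_tangent : forall u, exp m * (1 + u - m) <= exp u).
{ intros u.
  replace (exp u) with (exp m * exp (u - m))
    by (rewrite <- exp_plus; f_equal; ring).
  apply Rmult_le_compat_l; [left; apply exp_pos |].
  generalize (exp_ineq1_le (u - m)); lra. }
pose proof (exp_tangent (ln z)) as Hz.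
pose proof (exp_tangent 0) as H1.
rewrite exp_ln in Hz by exact hz.
rewrite exp_0 in H1.
change (Rpower z th) with (exp m).
assert (Hm : exp m * m = exp m * (th * ln z)) by reflexivity.
nra.
Qed.

Lemma Rpower_inv_base (x y : R) : 0 < x -> Rpower (/ x) y = Rpower x (- y).
Proof.
intros hx; unfold Rpower; rewrite ln_Rinv by exact hx; f_equal; ring.
Qed.

Lemma Rpower_pos (x y : R) : 0 < Rpower x y.
Proof. apply exp_pos. Qed.

Lemma weighted_holder (v w x y q : R) :
  0 < v -> 0 < w -> 0 < x -> 0 < y -> 1 <= q ->
  v * x + w * y
  <= Rpower (v + w) (1 - 1 / q)
     * Rpower (v * Rpower x q + w * Rpower y q) (1 / q).
Proof.
intros hv hw hx hy hq.
set (S := v * Rpower x q + w * Rpower y q).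
(* Sum the tangent bounds for the concave map [z => z^(1/q)] at [1], taken at
   [x^q (v + w) / S] and [y^q (v + w) / S], whose weighted mean is [1]. *)
assert (hS : 0 < S).
{ unfold S; pose proof (Rpower_pos x q); pose proof (Rpower_pos y q); nra. }
assert (hW : 0 < v + w) by lra.
assert (hth : 0 <= 1 / q <= 1).
{ split; [apply Rdiv_le_0_compat; lra |].
  apply Rmult_le_reg_r with q; [lra |]; field_simplify; lra. }
set (K := Rpower (S * / (v + w)) (1 / q)).
assert (hSW : 0 < S * / (v + w)) by (apply Rdiv_lt_0_compat; lra).
assert (hK : Rpower (v + w) (1 - 1 / q) * Rpower S (1 / q) = (v + w) * K).
{ unfold K; rewrite <- Rpower_mult_distr
    by (exact hS || now apply Rinv_0_lt_compat).
  rewrite Rpower_inv_base by exact hW.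
  unfold Rminus; rewrite Rpower_plus, Rpower_1 by exact hW; ring. }
rewrite hK.
assert (root : forall z, 0 < z ->
  z <= K * (1 + 1 / q * (Rpower z q * (v + w) / S - 1))).
{ intros z hz.
  pose proof (Rpower_pos z q) as hzq.
  assert (h : 0 < Rpower z q * (v + w) / S).
  { apply Rdiv_lt_0_compat; [apply Rmult_lt_0_compat |]; lra. }
  apply Rle_trans with (K * Rpower (Rpower z q * (v + w) / S) (1 / q)).
  - right; unfold K; rewrite Rpower_mult_distr by assumption.
    replace (S * / (v + w) * (Rpower z q * (v + w) / S)) with (Rpower z q)
      by (field; lra).
    rewrite Rpower_mult; replace (q * (1 / q)) with 1 by (field; lra).
    now rewrite Rpower_1.
  - apply Rmult_le_compat_l; [left; apply Rpower_pos |].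
    now apply Rpower_le_tangent. }
apply Rle_trans with
  (v * (K * (1 + 1 / q * (Rpower x q * (v + w) / S - 1)))
   + w * (K * (1 + 1 / q * (Rpower y q * (v + w) / S - 1)))).
{ apply Rplus_le_compat; (apply Rmult_le_compat_l; [lra | now apply root]). }
right.
(* The added multiple of [S / S - 1] is zero. It provides a numerator [S] that can be unfolded alone
   into its two terms, while the denominators stay folded. *)
replace ((v + w) * K)
  with ((v + w) * K + K * (1 / q) * (v + w) * (S / S - 1)) by (field; lra).
unfold S at 3; field; lra.
Qed.

Lemma nonneg_of_derive_nonneg (f df : R -> R) :
  f 1 = 0 ->
  (forall x, 1 <= x -> is_derive f x (df x) /\ 0 <= df x) ->
  forall x, 1 <= x -> 0 <= f x.
Proof.
intros f1 hf x hx.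
destruct (Req_dec x 1) as [-> | hx1]; [lra |].
destruct (MVT_cor2 f df 1 x) as [c [hc [hc1 _]]]; [lra | |].
{ intros c hc; apply is_derive_Reals; apply hf; lra. }
destruct (hf c) as [_ hdf]; [lra |].
nra.
Qed.

Lemma ln_lower_bound (x : R) : 1 <= x -> 2 * (x - 1) / (x + 1) <= ln x.
Proof.
intros hx.
enough (0 <= ln x - 2 * (x - 1) / (x + 1)) by lra.
apply (nonneg_of_derive_nonneg (fun x => ln x - 2 * (x - 1) / (x + 1))
         (fun x => (x - 1) ^ 2 / (x * (x + 1) ^ 2))); [| | exact hx].
{ rewrite ln_1; field. }
intros y hy; split.
{ auto_derive; [lra |]; field; lra. }
apply Rdiv_le_0_compat; [apply pow2_ge_0 |].
apply Rmult_lt_0_compat; [lra | apply pow_lt; lra].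
Qed.

(** Doubled at [x = sqrt t], this becomes [ln t <= (t - 1) / sqrt t]. *)
Lemma ln_upper_bound (x : R) : 1 <= x -> ln x <= (x ^ 2 - 1) / (2 * x).
Proof.
intros hx.
enough (0 <= (x ^ 2 - 1) / (2 * x) - ln x) by lra.
apply (nonneg_of_derive_nonneg (fun x => (x ^ 2 - 1) / (2 * x) - ln x)
         (fun x => (x - 1) ^ 2 / (2 * x ^ 2))); [| | exact hx].
{ rewrite ln_1; field. }
intros y hy; split.
{ auto_derive; [lra |]; field; lra. }
apply Rdiv_le_0_compat; [apply pow2_ge_0 |].
apply Rmult_lt_0_compat; [lra | apply pow_lt; lra].
Qed.

Lemma ln_ge_one_minus_inv (t : R) : 1 <= t -> 1 - 1 / t <= ln t.
Proof.
intros ht.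
pose proof (exp_ineq1_le (- ln t)) as h.
rewrite exp_Ropp, exp_ln in h by lra; unfold Rdiv; lra.
Qed.

Lemma mean_bound_normalized (t : R) : 1 < t ->
  Rabs (1 - (2 * t + 1) * ln t / (2 * (t - 1)) + 1 / 2 * ln ((1 + t) / 2))
  <= (10 + 7 * t + 7 / t) / 48.
Proof.
intros ht.
apply Rabs_le; split.
- set (s := sqrt t).
  assert (hs2 : t = s ^ 2) by (unfold s; rewrite pow2_sqrt; lra).
  assert (hs : 1 < s).
  { unfold s; rewrite <- sqrt_1; apply sqrt_lt_1; lra. }
  assert (hA : (t - 1) / (t + 3) <= 1 / 2 * ln ((1 + t) / 2)).
  { pose proof (ln_lower_bound ((1 + t) / 2) ltac:(lra)) as h.
    replace ((t - 1) / (t + 3))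
      with (1 / 2 * (2 * ((1 + t) / 2 - 1) / ((1 + t) / 2 + 1)))
      by (field; lra).
    lra. }
  assert (hL : (2 * t + 1) * ln t / (2 * (t - 1)) <= (2 * t + 1) / (2 * s)).
  { assert (h : ln t <= (t - 1) / s).
    { pose proof (ln_upper_bound s ltac:(lra)) as h.
      rewrite hs2; replace (s ^ 2) with (s * s) at 1 by ring.
      rewrite ln_mult by lra.
      replace ((s ^ 2 - 1) / s) with (2 * ((s ^ 2 - 1) / (2 * s)))
        by (field; lra).
      lra. }
    replace ((2 * t + 1) / (2 * s))
      with ((2 * t + 1) * ((t - 1) / s) / (2 * (t - 1))) by (field; lra).
    apply Rmult_le_compat_r.
    { left; apply Rinv_0_lt_compat; lra. }
    apply Rmult_le_compat_l; lra. }
  enough (0 <= (10 + 7 * t + 7 / t) / 48 + 1 - (2 * t + 1) / (2 * s)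
               + (t - 1) / (t + 3)) by lra.
  rewrite hs2.
  (* Over the denominator [48 s^2 (s^2 + 3)] the numerator has a double root at [s = 1], where the
     bound becomes an equality. The cofactor [7 s^4 - 34 s^3 + 52 s^2 - 30 s + 21] is positive by
     completing squares twice. *)
  replace ((10 + 7 * s ^ 2 + 7 / s ^ 2) / 48 + 1 - (2 * s ^ 2 + 1) / (2 * s)
           + (s ^ 2 - 1) / (s ^ 2 + 3))
    with ((s - 1) ^ 2 * (7 * (s ^ 2 - 17 / 7 * s + 1 / 2) ^ 2
                         + 26 / 7 * (s - 7 / 4) ^ 2 + 63 / 8)
          / (48 * s ^ 2 * (s ^ 2 + 3)))
    by (field; nra).
  apply Rdiv_le_0_compat; [| nra].
  apply Rmult_le_pos; [apply pow2_ge_0 |].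
  pose proof (pow2_ge_0 (s ^ 2 - 17 / 7 * s + 1 / 2)).
  pose proof (pow2_ge_0 (s - 7 / 4)).
  lra.
(* Split [2 t + 1 = (t + 2) + (t - 1)]: the second part yields [ln t / 2], which absorbs the term in
   [ln ((1 + t) / 2)]. What is left is at most [1 / 2 - 1 / t], whereas the right-hand side is at
   least [1 / 2] because [t + 1 / t >= 2]. *)
- assert (h0 : 1 - 1 / t <= ln t) by (apply ln_ge_one_minus_inv; lra).
  assert (hA : ln ((1 + t) / 2) <= ln t) by (apply ln_le; lra).
  assert (hlt : (t + 2) / (2 * t) <= (t + 2) * ln t / (2 * (t - 1))).
  { replace ((t + 2) / (2 * t))
      with ((t + 2) * (1 - 1 / t) / (2 * (t - 1))) by (field; lra).
    apply Rmult_le_compat_r.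
    { left; apply Rinv_0_lt_compat; lra. }
    apply Rmult_le_compat_l; lra. }
  replace ((2 * t + 1) * ln t / (2 * (t - 1)))
    with ((t + 2) * ln t / (2 * (t - 1)) + 1 / 2 * ln t) by (field; lra).
  replace ((t + 2) / (2 * t)) with (1 / 2 + 1 / t) in hlt by (field; lra).
  assert (0 < 1 / t) by (apply Rdiv_lt_0_compat; lra).
  assert (2 <= t + 1 / t).
  { enough (0 <= (t - 1) ^ 2 / t)
      by (replace (t + 1 / t) with (2 + (t - 1) ^ 2 / t) by (field; lra); lra).
    apply Rdiv_le_0_compat; [apply pow2_ge_0 | lra]. }
  replace (7 / t) with (7 * (1 / t)) by (field; lra).
  lra.
Qed.

Theorem proposition9 (a b q : R) (ha : 0 < a) (hab : a < b) (hq : 1 <= q) :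
  Rabs (- ln (identric_mean a b)
        + ln (Rpower a b / Rpower b a) / (2 * (b - a))
        + 1 / 2 * ln (arithmetic_mean a b))
  <= Rpower (arithmetic_mean a b) (1 - 1 / q) / (4 * Rpower 12 (1 / q))
     * (Rpower (Rpower b (- q) * (2 * a + b)
                + Rpower a (- q) * (4 * a + 5 * b)) (1 / q)
        + Rpower (Rpower a (- q) * (a + 2 * b)
                  + Rpower b (- q) * (5 * a + 4 * b)) (1 / q)).
Proof.
assert (hb : 0 < b) by lra.
assert (hA : 0 < arithmetic_mean a b) by (unfold arithmetic_mean; lra).
(* The total weight enters as [(12 A)^(1 - 1/q)], and [12^(1 - 1/q) = 12 / 12^(1/q)] produces the
   constant of the theorem. *)
assert (holder : forall x y v w, 0 < x -> 0 < y -> 0 < v -> 0 < w ->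
  v + w = 12 * arithmetic_mean a b ->
  v * / x + w * / y
  <= 12 * (Rpower (arithmetic_mean a b) (1 - 1 / q) / Rpower 12 (1 / q)
     * Rpower (Rpower x (- q) * v + Rpower y (- q) * w) (1 / q))).
{ intros x y v w hx hy hv hw hvw.
  eapply Rle_trans.
  { apply (weighted_holder v w (/ x) (/ y) q); try assumption;
      now apply Rinv_0_lt_compat. }
  right; rewrite !Rpower_inv_base by assumption.
  rewrite hvw, <- Rpower_mult_distr by (lra || assumption).
  replace (Rpower 12 (1 - 1 / q)) with (12 / Rpower 12 (1 / q)).
  2: { unfold Rminus; rewrite Rpower_plus, Rpower_Ropp, Rpower_1 by lra.
       reflexivity. }
  rewrite (Rmult_comm v), (Rmult_comm w).
  field; apply Rgt_not_eq, Rpower_pos. }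
pose proof (holder b a (2 * a + b) (4 * a + 5 * b) hb ha ltac:(lra) ltac:(lra)
  ltac:(unfold arithmetic_mean; field)) as h1.
pose proof (holder a b (a + 2 * b) (5 * a + 4 * b) ha hb ltac:(lra) ltac:(lra)
  ltac:(unfold arithmetic_mean; field)) as h2.
clear holder.
match goal with |- _ <= ?P / (4 * ?T) * (?X + ?Y) =>
  replace (P / (4 * T) * (X + Y)) with (1 / 4 * (P / T * X + P / T * Y))
    by (field; apply Rgt_not_eq, Rpower_pos)
end.
(* Here [1 / 48] is the outer [1 / 4] times the [1 / 12] from [holder]; with [t = b / a] the sum in
   parentheses is [10 + 7 t + 7 / t]. *)
apply Rle_trans with
  (1 / 48 * (((2 * a + b) * / b + (4 * a + 5 * b) * / a)
             + ((a + 2 * b) * / a + (5 * a + 4 * b) * / b))).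
2: lra.
assert (ht : 1 < b / a).
{ apply Rmult_lt_reg_r with a; [exact ha |]; field_simplify; lra. }
pose proof (mean_bound_normalized (b / a) ht) as h.
assert (ln_t : ln (b / a) = ln b - ln a) by (apply ln_div; lra).
assert (ln_mean : ln ((1 + b / a) / 2) = ln (arithmetic_mean a b) - ln a).
{ rewrite <- ln_div by assumption; f_equal; unfold arithmetic_mean; field; lra. }
assert (ln_identric :
  ln (identric_mean a b) = (b * ln b - a * ln a) / (b - a) - 1).
{ unfold identric_mean.
  assert (hq' : 0 < Rpower b b / Rpower a a)
    by (apply Rdiv_lt_0_compat; apply Rpower_pos).
  pose proof (exp_pos 1).
  rewrite ln_mult by (apply Rpower_pos || (apply Rdiv_lt_0_compat; lra)).
  unfold Rpower at 1; rewrite ln_exp.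
  rewrite (ln_div (Rpower b b)) by apply Rpower_pos.
  rewrite ln_div, ln_1, ln_exp by lra.
  unfold Rpower; rewrite !ln_exp; field; lra. }
(* After substituting [ln b = ln a + ln t], the terms in [ln a] add up to [- ln a / 2], exactly what
   turns [ln A / 2] into [ln ((1 + t) / 2) / 2]. *)
rewrite ln_identric, ln_div by apply Rpower_pos.
unfold Rpower; rewrite !ln_exp.
rewrite ln_t, ln_mean in h.
eapply Rle_trans; [right | eapply Rle_trans; [exact h | right; field; lra]].
f_equal; field; lra.
Qed.
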